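(* Let $R$ be a reduced arithmetical ring. Then, for each prime ideal $P$ of $R$ such that $P^n$ is finitely generated for some integer $n>0$, $P$ is finitely generated.
   Context: All rings are commutative with identity. A ring is a chain ring if its lattice of ideals is totally ordered by inclusion. A ring $R$ is arithmetical if the localization $R_M$ is a chain ring for each maximal ideal $M$ of $R$. *)

(* Defs.v *)
From HB Require Import structures.
From mathcomp Require Import all_boot all_order all_algebra.
From mathcomp Require Import ring.
From mathcomp Require Import boolp classical_sets.

Set Implicit Arguments.
Unset Strict Implicit.
Unset Printing Implicit Defensive.

Import GRing.Theory.
Local Open Scope classical_set_scope.
Local Open Scope ring_scope.
Local Open Scope quotient_scope.

(* Rings are [comPzRingType]s, so the zero ring is allowed.  The ideals of
   [ring_quotient] are not used: they are proper by definition and only exist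
   over nontrivial rings. *)

Section Ideals.
Variable R : comPzRingType.
Implicit Types I J P M : set R.

Definition is_ideal I : Prop :=
  [/\ I 0, forall x y, I x -> I y -> I (x + y) & forall a x, I x -> I (a * x)].

Definition ideal_gen (A : set R) : set R := smallest is_ideal A.

Definition ideal_mul I J : set R :=
  ideal_gen [set z | exists x y, [/\ I x, J y & z = x * y]].

(* The zeroth power is the unit ideal. *)
Definition ideal_exp I (n : nat) : set R := iter n (ideal_mul I) setT.

Definition finitely_generated I : Prop :=
  exists s : seq R, I = ideal_gen [set x | x \in s].

Definition prime_ideal P : Prop :=
  [/\ is_ideal P, P <> setT & forall x y, P (x * y) -> P x \/ P y].

Definition maximal_ideal M : Prop :=
  [/\ is_ideal M, M <> setT
    & forall J, is_ideal J -> M `<=` J -> J = M \/ J = setT].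

Definition mult_closed (S : set R) : Prop :=
  S 1 /\ forall x y, S x -> S y -> S (x * y).

Lemma maximal_compl_mult_closed M : maximal_ideal M -> mult_closed (~` M).
Proof.
move=> [[M0 MD MM] MnT Mmax]; split.
  by move=> M1; apply: MnT; apply/seteqP; split=> // x _; rewrite -[x]mulr1; exact: MM.
move=> x y nMx nMy Mxy; apply: nMx.
pose J : set R := [set z | exists m a, M m /\ z = m + a * x].
have JI : is_ideal J.
  split; first by exists 0, 0; rewrite mul0r addr0.
    move=> _ _ [m [a [Mm ->]]] [m' [a' [Mm' ->]]]; exists (m + m'), (a + a').
    by split; [exact: MD | rewrite mulrDl addrACA].
  move=> b _ [m [a [Mm ->]]]; exists (b * m), (b * a).
  by split; [exact: MM | rewrite mulrDr mulrA].
have MJ : M `<=` J by move=> m Mm; exists m, 0; rewrite mul0r addr0.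
case: (Mmax J JI MJ) => [<-|JT]; first by exists 0, 1; rewrite mul1r add0r.
have [m [a [Mm e1]]] : J 1 by rewrite JT.
exfalso; apply: nMy; rewrite -[y]mul1r e1 mulrDl; apply: MD.
  by rewrite mulrC; exact: MM.
by rewrite -mulrA; exact: MM.
Qed.

End Ideals.

Definition chain_ring (R : comPzRingType) : Prop :=
  forall I J : set R, is_ideal I -> is_ideal J -> I `<=` J \/ J `<=` I.

Definition reduced (R : comPzRingType) : Prop :=
  forall (x : R) (n : nat), x ^+ n = 0 -> x = 0.

Module Localization.
Section Construction.
Variables (R : comPzRingType) (S : set R) (hS : mult_closed S).

Local Notation den_type := {s : R | s \in S}.
Local Notation "'\n_' p" := (p.1 : R) (at level 8, p at level 2).
Local Notation "'\d_' p" := (sval p.2 : R) (at level 8, p at level 2).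

Lemma denP (s : den_type) : S (sval s). Proof. exact: set_mem (valP s). Qed.

Definition den1 : den_type := exist _ 1 (mem_set hS.1).
Definition denM (s t : den_type) : den_type :=
  exist _ (sval s * sval t) (mem_set (hS.2 _ _ (denP s) (denP t))).

(* The factor [t] is needed because [S] may contain zero divisors. *)
Definition equivl (p q : R * den_type) : bool :=
  `[< exists2 t, S t & t * (\n_p * \d_q) = t * (\n_q * \d_p) >].

Lemma equivl_refl : reflexive equivl.
Proof. by move=> p; apply/asboolP; exists 1 => //; exact: hS.1. Qed.

Lemma equivl_sym : symmetric equivl.
Proof. by move=> p q; apply/asboolP/asboolP => -[t St e]; exists t. Qed.

Lemma equivl_trans : transitive equivl.
Proof.
move=> q p r /asboolP[t St e] /asboolP[u Su f]; apply/asboolP.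
exists (t * u * \d_q); first by do 2?apply: hS.2 => //; exact: denP.
transitivity (u * \d_r * (t * (\n_p * \d_q))); first by ring.
rewrite e; transitivity (t * \d_p * (u * (\n_q * \d_r))); first by ring.
by rewrite f; ring.
Qed.

Canonical equivl_equiv := EquivRel equivl equivl_refl equivl_sym equivl_trans.

Definition type : Type := {eq_quot equivl}.
HB.instance Definition _ : EqQuotient _ equivl type := EqQuotient.on type.
HB.instance Definition _ := Choice.on type.

Definition frac (x : R) (s : den_type) : type := \pi_type (x, s).

Lemma frac_eqP x s y t :
  frac x s = frac y t <-> exists2 u, S u & u * (x * sval t) = u * (y * sval s).
Proof.
split=> [/eqmodP/asboolP //|e].
by apply/eqmodP/asboolP.
Qed.

Lemma fracW (Q : type -> Prop) : (forall x s, Q (frac x s)) -> forall a, Q a.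
Proof. by move=> Qf; elim/quotW=> -[x s]; exact: Qf. Qed.

Definition add (a b : type) : type :=
  let: (p, q) := (repr a, repr b) in
  frac (\n_p * \d_q + \n_q * \d_p) (denM p.2 q.2).
Definition opp (a : type) : type := frac (- \n_(repr a)) (repr a).2.
Definition mul (a b : type) : type :=
  let: (p, q) := (repr a, repr b) in frac (\n_p * \n_q) (denM p.2 q.2).

Lemma repr_frac x s :
  exists2 u, S u & u * (\n_(repr (frac x s)) * sval s) = u * (x * \d_(repr (frac x s))).
Proof.
by apply/frac_eqP; rewrite {1}/frac -surjective_pairing reprK.
Qed.

Lemma add_frac x s y t :
  add (frac x s) (frac y t) = frac (x * sval t + y * sval s) (denM s t).
Proof.
rewrite /add; apply/frac_eqP => /=.
have [u Su e] := repr_frac x s; have [v Sv f] := repr_frac y t.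
move: (repr (frac x s)) (repr (frac y t)) e f => p q e f.
exists (u * v); first exact: hS.2.
transitivity (u * (\n_p * sval s) * (v * \d_q * sval t)
  + v * (\n_q * sval t) * (u * \d_p * sval s)); first by ring.
by rewrite e f; ring.
Qed.

Lemma opp_frac x s : opp (frac x s) = frac (- x) s.
Proof.
apply/frac_eqP; have [u Su e] := repr_frac x s; exists u => //.
move: (repr (frac x s)) e => p e.
by transitivity (- (u * (\n_p * sval s))); [|rewrite e]; ring.
Qed.

Lemma mul_frac x s y t : mul (frac x s) (frac y t) = frac (x * y) (denM s t).
Proof.
rewrite /mul; apply/frac_eqP => /=.
have [u Su e] := repr_frac x s; have [v Sv f] := repr_frac y t.
move: (repr (frac x s)) (repr (frac y t)) e f => p q e f.
exists (u * v); first exact: hS.2.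
transitivity (u * (\n_p * sval s) * (v * (\n_q * sval t))); first by ring.
by rewrite e f; ring.
Qed.

Let frac_eq x s y t : x * sval t = y * sval s -> frac x s = frac y t.
Proof.
by move=> e; apply/frac_eqP; exists 1; [exact: hS.1|rewrite e].
Qed.

Lemma addA : associative add.
Proof.
elim/fracW=> x s; elim/fracW=> y t; elim/fracW=> z u.
by rewrite !add_frac; apply: frac_eq => /=; ring.
Qed.

Lemma addC : commutative add.
Proof.
elim/fracW=> x s; elim/fracW=> y t.
by rewrite !add_frac; apply: frac_eq => /=; ring.
Qed.

Lemma add0 : left_id (frac 0 den1) add.
Proof. by elim/fracW=> x s; rewrite add_frac; apply: frac_eq => /=; ring. Qed.

Lemma addN : left_inverse (frac 0 den1) opp add.
Proof.
by elim/fracW=> x s; rewrite opp_frac add_frac; apply: frac_eq => /=; ring.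
Qed.

HB.instance Definition _ := GRing.isZmodule.Build type addA addC add0 addN.

Lemma mulA : associative mul.
Proof.
elim/fracW=> x s; elim/fracW=> y t; elim/fracW=> z u.
by rewrite !mul_frac; apply: frac_eq => /=; ring.
Qed.

Lemma mulC : commutative mul.
Proof.
elim/fracW=> x s; elim/fracW=> y t.
by rewrite !mul_frac; apply: frac_eq => /=; ring.
Qed.

Lemma mul1 : left_id (frac 1 den1) mul.
Proof. by elim/fracW=> x s; rewrite mul_frac; apply: frac_eq => /=; ring. Qed.

Lemma mulDl : left_distributive mul add.
Proof.
elim/fracW=> x s; elim/fracW=> y t; elim/fracW=> z u.
by rewrite !(add_frac, mul_frac); apply: frac_eq => /=; ring.
Qed.

HB.instance Definition _ :=
  GRing.Zmodule_isComPzRing.Build type mulA mulC mul1 mulDl.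

End Construction.
End Localization.
HB.export Localization.

Definition localization (R : comPzRingType) (S : set R) (hS : mult_closed S)
  : comPzRingType := Localization.type hS.

Definition localization_at_maximal (R : comPzRingType) (M : set R)
    (hM : maximal_ideal M) : comPzRingType :=
  localization (maximal_compl_mult_closed hM).

Definition arithmetical (R : comPzRingType) : Prop :=
  forall (M : set R) (hM : maximal_ideal M), chain_ring (localization_at_maximal hM).

(* Main.v *)
Require Import Defs.
From mathcomp Require Import all_boot all_order all_algebra.
From mathcomp Require Import boolp classical_sets.
From mathcomp Require Import ring.

(** The localizations of a reduced arithmetical ring at maximal ideals are
    valuation domains.  If every element of [P] vanishes in the localization at
    [P], then [P] is locally zero or the unit ideal, so [P = P^n].  Otherwise
    take a maximal ideal [M] above [P]: locally at [M], the finitely generated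
    ideal [P^n] is generated by a single product [q * y] with [q] in [P] and [y]
    in [P^(n-1)]; cancelling [y] shows that [q] generates [P] locally at [M].  A
    nonzero principal prime of a valuation domain is maximal, so [P = M], and
    [P = P^n + (q)] is finitely generated. *)

Set Implicit Arguments.
Unset Strict Implicit.
Unset Printing Implicit Defensive.

Import GRing.Theory.
Local Open Scope classical_set_scope.
Local Open Scope ring_scope.

Lemma principal_ideal (R : comPzRingType) (b : R) :
  is_ideal [set z | exists c, z = c * b].
Proof.
split=> [|_ _ [c ->] [d ->]|a _ [c ->]]; first by exists 0; rewrite mul0r.
  by exists (c + d); rewrite mulrDl.
by exists (a * c); rewrite mulrA.
Qed.

(** * Ideal powers, maximal ideals and local divisibility *)

Section IdealTheory.
Variable R : comPzRingType.
Implicit Types I J P M : set R.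

Lemma ideal_gen_ideal (A : set R) : is_ideal (ideal_gen A).
Proof.
split=> [I [[I0 _ _] _] //|x y Ax Ay I II|a x Ax I II].
  by case: (II) => -[_ ID _] _; apply: ID; [exact: Ax|exact: Ay].
by case: (II) => -[_ _ IM] _; apply: IM; exact: Ax.
Qed.

Lemma ideal_gen_mem (A : set R) x : A x -> ideal_gen A x.
Proof. by move=> Ax I [_]; exact. Qed.

Lemma ideal_gen_sub (A I : set R) : is_ideal I -> A `<=` I -> ideal_gen A `<=` I.
Proof. by move=> II AI x; apply. Qed.

Lemma ideal_exp_ideal I n : is_ideal (ideal_exp I n).
Proof. by case: n => [|n]; [split|exact: ideal_gen_ideal]. Qed.

Lemma ideal_exp_mulS I n x y :
  I x -> ideal_exp I n y -> ideal_exp I n.+1 (x * y).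
Proof. by move=> Ix Iy; apply: ideal_gen_mem; exists x, y. Qed.

Lemma ideal_exp_expr I n x : I x -> ideal_exp I n (x ^+ n).
Proof.
by move=> Ix; elim: n => [//|n IHn]; rewrite exprS; exact: ideal_exp_mulS.
Qed.

Lemma ideal_expS_sub I n : is_ideal I -> ideal_exp I n.+1 `<=` I.
Proof.
move=> II; apply: ideal_gen_sub => // _ [x [y [Ix _ ->]]].
by case: II => _ _ IM; rewrite mulrC; exact: IM.
Qed.

Lemma prime_ideal1 P : prime_ideal P -> ~ P 1.
Proof.
move=> [[_ _ PM] PnT _] P1; apply: PnT; apply/seteqP; split=> // x _.
by rewrite -[x]mulr1; exact: PM.
Qed.

Lemma exists_maximal_ideal J : is_ideal J -> ~ J 1 ->
  exists2 M, maximal_ideal M & J `<=` M.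
Proof.
move=> JI J1; have [J0 _ _] := JI.
(* The empty set is admitted because it is the union of the empty chain. *)
pose Q : set (set R) :=
  [set X | X = set0 \/ [/\ is_ideal X, J `<=` X & ~ X 1]].
have Qin X x : Q X -> X x -> [/\ is_ideal X, J `<=` X & ~ X 1].
  by case=> [->|].
have [F FQ Ftot|A [QA Amax]] := @Zorn_bigcup _ Q.
  have [->|/set0P[x [X FX Xx]]] := eqVneq (\bigcup_(X in F) X) set0; first by left.
  have [[X0 _ _] JX _] := Qin _ _ (FQ _ FX) Xx.
  right; split; last 2 first.
  - by move=> y /JX Xy; exists X.
  - by case=> Y FY Y1; case: (Qin _ _ (FQ _ FY) Y1).
  split; first by exists X.
  - move=> y z [Y FY Yy] [Z FZ Zz].
    have [[_ YD _] _ _] := Qin _ _ (FQ _ FY) Yy.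
    have [[_ ZD _] _ _] := Qin _ _ (FQ _ FZ) Zz.
    by case: (Ftot _ _ FY FZ) => [YZ|ZY];
      [exists Z => //; apply: ZD => //; exact: YZ
      |exists Y => //; apply: YD => //; exact: ZY].
  - move=> a y [Y FY Yy]; exists Y => //.
    by have [[_ _ YM] _ _] := Qin _ _ (FQ _ FY) Yy; exact: YM.
have [AI JA A1] : [/\ is_ideal A, J `<=` A & ~ A 1].
  case: QA => // A0; exfalso; apply: (Amax J); last by right; split.
  by rewrite A0; split=> // J00; exact: (J00 0 J0).
exists A => //; split=> // [AT|K KI AK]; first by apply: A1; rewrite AT.
have [K1|nK1] := pselect (K 1).
  right; apply/seteqP; split=> // x _; rewrite -[x]mulr1.
  by case: KI => _ _; apply.
left; apply: contrapT => KA; apply: (Amax K).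
  by split=> // KsubA; apply: KA; apply/seteqP.
by right; split=> // x /JA /AK.
Qed.

(* Divisibility of [x] by [y] in the localization of [R] at the complement
   of [M]. *)
Definition local_dvd M (x y : R) : Prop :=
  exists s c, ~ M s /\ s * x = c * y.

Lemma local_dvd_trans M x y z : maximal_ideal M ->
  local_dvd M x y -> local_dvd M y z -> local_dvd M x z.
Proof.
move=> /maximal_compl_mult_closed[_ MM] [s [c [Ms e]]] [t [d [Mt f]]].
exists (t * s), (c * d); split; first exact: MM.
by rewrite -mulrA e mulrCA f mulrA.
Qed.

Lemma local_dvd_ideal M y : maximal_ideal M ->
  is_ideal [set x | local_dvd M x y].
Proof.
move=> /maximal_compl_mult_closed[M1 MM]; split.
- by exists 1, 0; rewrite mulr0 mul0r.
- move=> x z [s [c [Ms e]]] [t [d [Mt f]]].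
  exists (s * t), (t * c + s * d); split; first exact: MM.
  transitivity (t * (s * x) + s * (t * z)); first by ring.
  by rewrite e f; ring.
- move=> a x [s [c [Ms e]]]; exists s, (a * c); split=> //.
  by rewrite mulrCA e mulrA.
Qed.

Lemma local_dvd_mulr M x y : maximal_ideal M -> local_dvd M (x * y) y.
Proof.
by move=> /maximal_compl_mult_closed[M1 _]; exists 1, x; rewrite mul1r.
Qed.

(** * Localizations as chain rings *)

Section Arithmetical.
Hypothesis harith : arithmetical R.

(** The principal ideals of the images of [x] and [y] are comparable in the chain ring; clearing
    denominators brings the divisibility back to [R]. *)
Lemma local_dvd_total M x y : maximal_ideal M ->
  local_dvd M x y \/ local_dvd M y x.
Proof.
move=> hM; pose hS := maximal_compl_mult_closed hM.
pose L := localization_at_maximal hM.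
pose inj x : L := Localization.frac hS x (Localization.den1 hS).
have sub_dvd a b : [set z : L | exists c, z = c * inj a] `<=`
    [set z : L | exists c, z = c * inj b] -> local_dvd M a b.
  move=> /(_ (inj a)) [|c]; first by exists 1; rewrite mul1r.
  elim/Localization.fracW: c => r s.
  rewrite [_ * _]Localization.mul_frac => /Localization.frac_eqP[u Mu /= e].
  (* Here [s] is the denominator of the coefficient, and [u] comes from the equality of
     fractions. *)
  exists (u * sval s), (u * r); split.
    by apply: hS.2 => //; exact: Localization.denP.
  transitivity (u * (a * (sval s * 1))); first by ring.
  by rewrite e; ring.
by case: (harith (principal_ideal (inj x)) (principal_ideal (inj y))) => /sub_dvd;
  [left|right].
Qed.

(** Among finitely many generators one locally divides all the others, by totality; the multiples of
    it form an ideal, which then contains [I]. *)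
Lemma fg_local_principal M I : maximal_ideal M ->
  finitely_generated I -> exists2 g, I g & forall x, I x -> local_dvd M x g.
Proof.
move=> hM [s ->]; elim: s => [|a s [g gI gP]].
  exists 0; first by case: (ideal_gen_ideal [set x : R | x \in [::]]).
  by apply: ideal_gen_sub; [exact: local_dvd_ideal|].
have dvd_refl x : local_dvd M x x by rewrite -{1}[x]mul1r; exact: local_dvd_mulr.
have [ag|ga] := local_dvd_total a g hM.
  exists g.
    apply: (ideal_gen_sub (ideal_gen_ideal _) _ gI) => x xs.
    by apply: ideal_gen_mem; rewrite /= inE [x \in s]xs orbT.
  apply: ideal_gen_sub; first exact: local_dvd_ideal.
  by move=> x; rewrite /= inE => /orP[/eqP-> //|xs]; apply: gP; exact: ideal_gen_mem.
exists a; first by apply: ideal_gen_mem; rewrite /= inE eqxx.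
apply: ideal_gen_sub; first exact: local_dvd_ideal.
move=> x; rewrite /= inE => /orP[/eqP-> //|xs].
by apply: local_dvd_trans ga => //; apply: gP; exact: ideal_gen_mem.
Qed.

(** One product suffices instead of a sum: of two products one locally divides the other, hence also
    the sum. *)
Lemma ideal_mul_local_dvd M I J z : maximal_ideal M -> is_ideal I -> is_ideal J ->
  ideal_mul I J z -> exists x y, [/\ I x, J y & local_dvd M z (x * y)].
Proof.
move=> hM [I0 _ _] [J0 _ _].
pose K : set R := [set z | exists x y, [/\ I x, J y & local_dvd M z (x * y)]].
apply: (@ideal_gen_sub _ K) => [|_ [x [y [Ix Jy ->]]]]; last first.
  by exists x, y; split=> //; rewrite -{1}[_ * _]mul1r; exact: local_dvd_mulr.
split.
- by exists 0, 0; split=> //; case: (local_dvd_ideal (0 * 0) hM).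
- move=> a b [x [y [Ix Jy axy]]] [x' [y' [Ix' Jy' bxy]]].
  have [le|le] := local_dvd_total (x * y) (x' * y') hM.
    exists x', y'; split=> //; have [_ D _] := local_dvd_ideal (x' * y') hM.
    by apply: D => //; exact: local_dvd_trans le.
  exists x, y; split=> //; have [_ D _] := local_dvd_ideal (x * y) hM.
  by apply: D => //; exact: local_dvd_trans le.
- move=> a b [x [y [Ix Jy bxy]]]; exists x, y; split=> //.
  by have [_ _ D] := local_dvd_ideal (x * y) hM; exact: D.
Qed.

(** * Localizations as domains *)

Section Reduced.
Hypothesis hred : reduced R.

Lemma reduced_sqr (x : R) : x * x = 0 -> x = 0.
Proof. by rewrite -expr2; exact: hred. Qed.

(** If [s * x = c * y], then the square of [s * x] is a multiple of [x * y = 0], so [s * x = 0]; the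
    other case is symmetric. *)
Lemma local_domain M x y : maximal_ideal M -> x * y = 0 ->
  (exists2 s, ~ M s & s * x = 0) \/ (exists2 s, ~ M s & s * y = 0).
Proof.
move=> hM xy0; have [[s [c [Ms e]]]|[s [c [Ms e]]]] := local_dvd_total x y hM.
  left; exists s => //; apply: reduced_sqr.
  transitivity (s * c * (x * y)); last by rewrite xy0 mulr0.
  by rewrite {2}e; ring.
right; exists s => //; apply: reduced_sqr.
transitivity (s * c * (x * y)); last by rewrite xy0 mulr0.
by rewrite {2}e; ring.
Qed.

(** * Prime ideals with a finitely generated power *)

Section PrimeIdeal.
Variable P : set R.
Hypothesis hP : prime_ideal P.

Lemma locally_zero_prime_idempotent n :
  (forall x, P x -> exists2 s, ~ P s & s * x = 0) -> P `<=` ideal_exp P n.+1.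
Proof.
move=> Pz x Px; have [[P0 PD PM] _ Pp] := hP; have [E0 ED EM] := ideal_exp_ideal P n.+1.
(* The colon ideal of [P^(n+1)] by [x]; it contains 1 because no maximal ideal contains it. *)
pose A : set R := [set e | ideal_exp P n.+1 (e * x)].
have AI : is_ideal A.
  split=> [|a b Aa Ab|a b Ab]; rewrite /A /= ?mul0r // ?mulrDl -?mulrA.
  - exact: ED.
  - exact: EM.
apply: contrapT => nEx; have [|M hM AM] := exists_maximal_ideal AI.
  by rewrite /A /= mul1r.
have [_ McM] := maximal_compl_mult_closed hM.
have PM' : P `<=` M.
  move=> p Pp'; apply: contrapT => nMp.
  have : M (p ^+ n).
    apply: AM; rewrite /A /= mulrC; apply: ideal_exp_mulS Px _.
    exact: ideal_exp_expr.
  elim: n {A AI AM E0 ED EM nEx} => [|k IHk]; last first.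
    rewrite exprS => Mk; apply: (McM p (p ^+ k)) => //; exact: IHk.
  by rewrite expr0; case: (maximal_compl_mult_closed hM).
have [s nPs sx0] := Pz x Px.
have [[t nMt tx0]|[t nMt ts0]] := local_domain hM (etrans (mulrC x s) sx0).
  by apply: nMt; apply: AM; rewrite /A /= tx0.
by have /Pp[/PM'|] : P (t * s) by rewrite ts0.
Qed.

(* The image of [z] in the localization at [P] is nonzero. *)
Variable z : R.
Hypotheses (Pz : P z) (z_neq0 : forall s, s * z = 0 -> P s).

(** A local divisor [y] of a power of [z] is nonzero at [M], since otherwise some element outside
    [M] would kill [z] and so lie in [P]. In a domain such a [y] cancels. *)
Lemma local_cancel M w y n : maximal_ideal M -> P `<=` M ->
  local_dvd M (z ^+ n) y -> w * y = 0 -> exists2 s, ~ M s & s * w = 0.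
Proof.
move=> hM PM [t [c [nMt e]]] wy0; have [_ _ Pp] := hP.
have [//|[s nMs sy0]] := local_domain hM wy0.
have [_ /(_ s t nMs nMt) nMst] := maximal_compl_mult_closed hM.
exfalso; apply/nMst/PM/z_neq0.
(* The exponent [n.+1] leaves the factor [s * t * z ^+ n] even when [n = 0]. *)
apply: (@hred _ n.+1); rewrite exprMn !exprS.
transitivity ((s * t) ^+ n * z * (s * (t * z ^+ n))); first by ring.
by rewrite e (mulrCA s c) sy0 !mulr0.
Qed.

Lemma power_fg_local_principal M n : maximal_ideal M -> P `<=` M ->
  finitely_generated (ideal_exp P n.+1) ->
  exists2 q, P q & forall x, P x -> local_dvd M x q.
Proof.
move=> hM PM /(fg_local_principal hM) [g Eg gP].
have [PI _ _] := hP; have [_ MM] := maximal_compl_mult_closed hM.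
have [q [y [Pq Ey gqy]]] := ideal_mul_local_dvd hM PI (ideal_exp_ideal P n) Eg.
exists q => // x Px.
(* Since [z ^+ n.+1] lies in [P^(n+1)], it is locally a multiple of [q * y]; this makes [y]
   cancellable. *)
have zy : local_dvd M (z ^+ n.+1) y.
  apply: local_dvd_trans (local_dvd_mulr q y hM) => //.
  by apply: local_dvd_trans gqy => //; apply: gP; exact: ideal_exp_expr.
have [s [c [nMs e]]] : local_dvd M (x * y) (q * y).
  by apply: local_dvd_trans gqy => //; apply: gP; exact: ideal_exp_mulS.
have [|t nMt f] := @local_cancel M (s * x - c * q) y n.+1 hM PM zy.
  by rewrite mulrBl -!mulrA e subrr.
exists (t * s), (t * c); split; first exact: MM.
by apply/eqP; rewrite -subr_eq0 -!mulrA -mulrBr f.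
Qed.

Lemma local_principal_prime_maximal M q : maximal_ideal M -> P `<=` M ->
  P q -> (forall x, P x -> local_dvd M x q) -> M `<=` P.
Proof.
move=> hM PM Pq qP t Mt; have [[P0 _ PMl] _ Pp] := hP.
have [_ MM] := maximal_compl_mult_closed hM; have [[_ MD MMl] _ _] := hM.
have nP s : ~ M s -> ~ P s by move=> nMs /PM.
have [[s [c [nMs e]]]|[s [c [nMs e]]]] := local_dvd_total t q hM.
  by have /Pp[/(nP _ nMs)|] : P (s * t) by rewrite e; exact: PMl.
have /Pp[/qP[s' [d [nMs' f]]]|//] : P (c * t) by rewrite -e; exact: PMl.
(* From [s * q = c * t] and [s' * c = d * q] follows [s' * s * q = d * t * q]; cancelling [q] puts a
   multiple of [s' * s] by an element outside [M] into [M]. *)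
have [] := @local_cancel M (s' * s - d * t) q 1 hM PM.
- by rewrite expr1; exact: qP.
- by rewrite mulrBl -mulrA e mulrA f; ring.
move=> u nMu u0; have nMss := MM _ _ nMu (MM _ _ nMs' nMs).
exfalso; apply: nMss.
suff -> : u * (s' * s) = u * d * t by exact: MMl.
by apply/eqP; rewrite -subr_eq0 -mulrA -mulrBr u0.
Qed.

Lemma nonzero_prime_decomposition n : finitely_generated (ideal_exp P n.+1) ->
  exists2 q, P q & forall x, P x -> exists y c, ideal_exp P n.+1 y /\ x = y + c * q.
Proof.
move=> fg; have [PI _ _] := hP.
have [M hM PM] := exists_maximal_ideal PI (prime_ideal1 hP).
have [q Pq qP] := power_fg_local_principal hM PM fg.
have MP := local_principal_prime_maximal hM PM Pq qP.
exists q => // x Px; have [s [c [nMs e]]] := qP x Px.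
have [[M0 MD MMl] _ Mmax] := hM.
(* As [s] is outside [M], the ideal [M + (s)] is everything, so [1 = p + a * s] with [p] in [M],
   hence in [P]. *)
pose K : set R := [set r | exists p a, M p /\ r = p + a * s].
have KI : is_ideal K.
  split; first by exists 0, 0; rewrite mul0r addr0.
    move=> _ _ [p [a [Mp ->]]] [p' [a' [Mp' ->]]]; exists (p + p'), (a + a').
    by split; [exact: MD|ring].
  move=> b _ [p [a [Mp ->]]]; exists (b * p), (b * a).
  by split; [exact: MMl|ring].
have [|KM|KT] := Mmax K KI.
- by move=> p Mp; exists p, 0; rewrite mul0r addr0.
- by exfalso; apply: nMs; rewrite -KM; exists 0, 1; rewrite mul1r add0r.
have [p [a [/MP Pp e1]]] : K 1 by rewrite KT.
(* Iterates [x = x * p + a * c * q]; for [k = n] the first term lies in [P^(n+1)]. *)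
have xE k : exists d, x = x * p ^+ k + d * q.
  elim: k => [|k [d IHk]]; first by exists 0; rewrite mul0r addr0 expr0 mulr1.
  exists (d + p ^+ k * a * c).
  rewrite {1}IHk -{1}[x]mul1r e1 exprS.
  transitivity (x * (p * p ^+ k) + (d * q + p ^+ k * a * (s * x))); first by ring.
  by rewrite e; ring.
have [d xd] := xE n; exists (x * p ^+ n), d; split=> //.
by apply: ideal_exp_mulS => //; exact: ideal_exp_expr.
Qed.

End PrimeIdeal.
End Reduced.
End Arithmetical.
End IdealTheory.

Theorem corollary4p4 (R : comPzRingType) (hred : reduced R) (harith : arithmetical R) :
  forall P : set R, prime_ideal P ->
  (exists n : nat, (0 < n)%N /\ finitely_generated (ideal_exp P n)) ->
  finitely_generated P.
Proof.
move=> P hP [[|n] [//_ fg]]; have [PI _ _] := hP.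
have EP := @ideal_expS_sub _ P n PI.
(* Either [P] vanishes in the localization at [P], or some [z] in [P] survives there. *)
have [Pz|/existsNP[z /not_implyP[Pz nz]]] :=
    pselect (forall x, P x -> exists2 s, ~ P s & s * x = 0).
  suff <- : ideal_exp P n.+1 = P by [].
  by apply/seteqP; split=> //; exact: locally_zero_prime_idempotent.
have z_neq0 s : s * z = 0 -> P s.
  by move=> sz0; apply: contrapT => nPs; apply: nz; exists s.
have [q Pq qP] := nonzero_prime_decomposition harith hred hP Pz z_neq0 fg.
have [s sE] := fg; exists (q :: s); apply/seteqP; split.
  move=> _ /qP[y [c [Ey ->]]].
  have [_ GD GM] := ideal_gen_ideal [set x | x \in q :: s].
  apply: GD; last by apply: GM; apply: ideal_gen_mem; rewrite /= inE eqxx.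
  move: Ey; rewrite sE; apply: ideal_gen_sub; first exact: ideal_gen_ideal.
  by move=> x xs; apply: ideal_gen_mem; rewrite /= inE [x \in s]xs orbT.
apply: ideal_gen_sub => // x; rewrite /= inE => /orP[/eqP-> //|xs].
by apply: EP; rewrite sE; exact: ideal_gen_mem.
Qed.
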